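(* For any fixed $\beta>0$, the mixing times of both the column dynamics $\mathcal M^{\mathrm{col}}_n$ and the single-site dynamics $\mathcal M^{\mathrm{ss}}_n$ are $\Omega(n^3)$.
   Context: Fix $\beta>0$, integer $n\ge1$. $\Omega_n=\{0,\dots,n\}^n$ with $\eta(0)=\eta(n+1)=0$; $\mu(\eta)\propto\exp\{-\beta\sum_{i=1}^{n+1}|\eta(i-1)-\eta(i)|\}$. Column dynamics: pick $i\in\{1,\dots,n\}$ uniformly and replace $\eta(i)$ by $j\in\{0,\dots,n\}$ with probability proportional to $\mu(\eta^j)$ ($\eta^j$ = $\eta$ with $\eta(i)$ replaced by $j$). Single-site dynamics: pick $i$ uniformly, let $a=\min\{\eta(i\pm1)\}$, $b=\max\{\eta(i\pm1)\}$; move to $\eta$ with $\eta(i)$ replaced by $\max\{\eta(i)-1,0\}$ with probability $p^-$ and by $\min\{\eta(i)+1,n\}$ with probability $p^+$, else stay, where $p^-=\frac14e^{-2\beta}$ if $\eta(i)\le a$ and $\frac14$ otherwise, $p^+=\frac14e^{-2\beta}$ if $\eta(i)\ge b$ and $\frac14$ otherwise. Mixing time: least $t$ such that the law at time $t$ from any starting configuration is within total variation $1/(2e)$ of $\mu$. *)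

(* Defs.v *)
From HB Require Import structures.
From mathcomp Require Import all_boot all_order all_algebra.
From mathcomp Require Import reals.
From mathcomp.analysis Require Import sequences exp.
Set Implicit Arguments. Unset Strict Implicit. Unset Printing Implicit Defensive.
Import Order.TTheory GRing.Theory Num.Theory.
Local Open Scope ring_scope.

Section SOS.
Variable R : realType.

(* Omega_n = {0,...,n}^n ; site i : 'I_n is the paper's position i+1. *)
Definition config (n : nat) := {ffun 'I_n -> 'I_n.+1}.

(* height at paper position j in {0,...,n+1}, with eta(0) = eta(n+1) = 0 *)
Definition ht (n : nat) (eta : config n) (j : nat) : nat :=
  if (0 < j)%N then
    (if @insub nat (fun k => (k < n)%N) 'I_n j.-1 is Some i then val (eta i) else 0%N)
  else 0%N.

Definition absdiff (a b : nat) : nat := ((a - b) + (b - a))%N.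

Definition Hsos (n : nat) (eta : config n) : nat :=
  (\sum_(j < n.+1) absdiff (ht eta j) (ht eta j.+1))%N.

Definition weight (beta : R) (n : nat) (eta : config n) : R :=
  expR (- beta * (Hsos eta)%:R).

Definition mu (beta : R) (n : nat) (eta : config n) : R :=
  weight beta eta / \sum_(x : config n) weight beta x.

Definition upd (n : nat) (eta : config n) (i : 'I_n) (j : 'I_n.+1) : config n :=
  [ffun k => if k == i then j else eta k].

Definition Pcol (beta : R) (n : nat) (eta eta' : config n) : R :=
  (n%:R)^-1 * \sum_(i < n) \sum_(j < n.+1)
     (eta' == upd eta i j)%:R * (mu beta (upd eta i j)
        / \sum_(j' < n.+1) mu beta (upd eta i j')).

Definition p_minus (beta : R) (n : nat) (eta : config n) (i : 'I_n) : R :=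
  if (val (eta i) <= minn (ht eta i) (ht eta i.+2))%N
  then expR (- (2 * beta)) / 4 else 1 / 4.

Definition p_plus (beta : R) (n : nat) (eta : config n) (i : 'I_n) : R :=
  if (maxn (ht eta i) (ht eta i.+2) <= val (eta i))%N
  then expR (- (2 * beta)) / 4 else 1 / 4.

Definition down (n : nat) (eta : config n) (i : 'I_n) : config n :=
  upd eta i (inord (val (eta i)).-1).

Definition up (n : nat) (eta : config n) (i : 'I_n) : config n :=
  upd eta i (inord (minn (val (eta i)).+1 n)).

Definition Pss (beta : R) (n : nat) (eta eta' : config n) : R :=
  (n%:R)^-1 * \sum_(i < n)
     ( p_minus beta eta i * (eta' == down eta i)%:R
     + p_plus beta eta i * (eta' == up eta i)%:R
     + (1 - p_minus beta eta i - p_plus beta eta i) * (eta' == eta)%:R ).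

Fixpoint law (T : finType) (P : T -> T -> R) (t : nat) (x : T) : T -> R :=
  match t with
  | 0%N => fun y => (y == x)%:R
  | t'.+1 => fun y => \sum_(z : T) law P t' x z * P z y
  end.

Definition dTV (T : finType) (p q : T -> R) : R :=
  2^-1 * \sum_(y : T) `|p y - q y|.

(* time t is such that the law from every start is within 1/(2e) of pi;
   the mixing time is the least such t *)
Definition mixed_at (T : finType) (P : T -> T -> R) (pi : T -> R) (t : nat) : Prop :=
  forall x : T, dTV (law P t x) pi <= (2 * expR 1)^-1.

End SOS.

(* Main.v *)
(** Both halves compare the chains started from the lowest and the highest flat
    configuration: if [t] is a mixing time, any observable with values in
    [[0, G]] has expectations at time [t] from two starting points that differ
    by at most [G / e].

    Single-site dynamics.  For a lazy reversible chain and [W = expR (alpha * D)]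
    with [D] 1-Lipschitz along transitions, one step increases the weighted norm
    of the density by a factor [1 + O(alpha^2)] only.  Hence from a state of
    stationary mass [expR (- L)] the mean displacement of [D] is
    [O(alpha * t + L / alpha)].  The flat configurations have [L = O(n)], and
    with [D] the area and [alpha] of order [1 / n] the displacement is a small
    fraction of [n^2] unless [t] is of order [n^3].

    Column dynamics.  Jumps are unbounded, but the heat-bath mean of [j^2] given
    neighbours [a], [b] is at most [(a^2 + b^2) / 2 + O(1)], whatever the floor
    and the ceiling do, and the same holds for [(n - j)^2].  Summing by parts
    against the weights [p * (n + 1 - p)], whose discrete Laplacian is [-2], the
    functionals [sum_p p (n + 1 - p) eta(p)^2] and
    [sum_p p (n + 1 - p) (n - eta(p))^2] grow by [O(n^2)] per step, while their
    range is of order [n^5]. *)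
Require Import Defs.
From HB Require Import structures.
From mathcomp Require Import all_boot all_order all_algebra.
From mathcomp Require Import reals.
From mathcomp.analysis Require Import sequences exp.
From mathcomp Require Import zify ring lra.
Import Order.TTheory GRing.Theory Num.Theory.
Local Open Scope ring_scope.
Local Set Implicit Arguments.
Local Unset Strict Implicit.

(** * Laws of a finite chain, expectations and total variation *)

Definition stochastic (R : realType) (T : finType) (P : T -> T -> R) : Prop :=
  (forall x y, 0 <= P x y) /\ (forall x, \sum_y P x y = 1).

Definition expect (R : realType) (T : finType) (p g : T -> R) : R :=
  \sum_y p y * g y.

Lemma law_ge0 (R : realType) (T : finType) (P : T -> T -> R) t x y :
  stochastic P -> 0 <= law P t x y.
Proof.
case=> P0 _; elim: t y => [|t IH] y /=; first by rewrite ler0n.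
by apply: sumr_ge0 => z _; rewrite mulr_ge0.
Qed.

Lemma law_sum1 (R : realType) (T : finType) (P : T -> T -> R) t x :
  stochastic P -> \sum_y law P t x y = 1.
Proof.
case=> P0 P1; elim: t => [|t IH] /=.
  rewrite (bigD1 x) //= eqxx big1 ?addr0 // => y /negbTE; first by move=> ->.
rewrite exchange_big /= -[RHS]IH; apply: eq_bigr => z _.
by rewrite -mulr_sumr P1 mulr1.
Qed.

Lemma expect_law0 (R : realType) (T : finType) (P : T -> T -> R) x g :
  expect (law P 0 x) g = g x.
Proof.
rewrite /expect (bigD1 x) //= eqxx mul1r big1 ?addr0 // => y /negbTE -> .
by rewrite mul0r.
Qed.

Lemma expect_lawS (R : realType) (T : finType) (P : T -> T -> R) t x g :
  expect (law P t.+1 x) g = expect (law P t x) (fun z => expect (P z) g).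
Proof.
rewrite /expect /=; under eq_bigr do rewrite mulr_suml.
rewrite exchange_big /=; apply: eq_bigr => z _.
by rewrite mulr_sumr; apply: eq_bigr => y _; rewrite mulrA.
Qed.

Lemma expect_drift (R : realType) (T : finType) (P : T -> T -> R) (g : T -> R) K t x :
  stochastic P -> (forall z, expect (P z) g <= g z + K) ->
  expect (law P t x) g <= g x + K * t%:R.
Proof.
move=> sP H; elim: t => [|t IH]; first by rewrite expect_law0 mulr0 addr0.
rewrite expect_lawS -natr1 mulrDr mulr1 addrA.
apply: (@le_trans _ _ (expect (law P t x) (fun z => g z + K))).
  by apply: ler_sum => z _; rewrite ler_wpM2l // law_ge0.
rewrite /expect; under eq_bigr do rewrite mulrDr.
by rewrite big_split /= -mulr_suml law_sum1 // mul1r lerD2r.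
Qed.

Lemma dTV_triangle (R : realType) (T : finType) (p q m : T -> R) :
  dTV p q <= dTV p m + dTV q m.
Proof.
rewrite /dTV -mulrDr ler_wpM2l ?invr_ge0 ?ler0n // -big_split /=.
apply: ler_sum => y _; rewrite [X in _ <= _ + X]distrC.
by rewrite -[p y - q y](subrKA (m y)) ler_normD.
Qed.

(** As [p] and [q] have the same mass, [g] may be recentred at [G / 2], where it is at most [G / 2]
    in absolute value; this half is the one in [dTV]. *)
Lemma expect_dTV (R : realType) (T : finType) (p q g : T -> R) (G : R) :
  \sum_y p y = 1 -> \sum_y q y = 1 -> (forall y, 0 <= g y <= G) ->
  expect p g - expect q g <= G * dTV p q.
Proof.
move=> p1 q1 gG.
have -> : expect p g - expect q g = \sum_y (p y - q y) * (g y - G / 2).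
  under eq_bigr do rewrite mulrBr mulrBl.
  by rewrite !sumrB -mulr_suml sumrB p1 q1 /expect; ring.
rewrite /dTV mulrA mulr_sumr; apply: ler_sum => y _.
apply: le_trans (ler_norm _) _; rewrite normrM mulrC ler_wpM2r //.
by rewrite ler_norml; have := gG y; lra.
Qed.

(** Both laws are within 1/(2e) of [m], hence within 1/e of each other; the bound e >= 2 then gives
    the factor 1/2. *)
Lemma mixed_expect_diff (R : realType) (T : finType) (P : T -> T -> R) (m g : T -> R)
    (G : R) t x x' :
  stochastic P -> mixed_at P m t -> (forall y, 0 <= g y <= G) ->
  expect (law P t x) g - expect (law P t x') g <= G / 2.
Proof.
move=> sP mix gG; have G0 : 0 <= G by have := gG x; lra.
apply: le_trans (expect_dTV (law_sum1 _ _ sP) (law_sum1 _ _ sP) gG) _.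
rewrite ler_wpM2l //; apply: le_trans (dTV_triangle _ _ m) _.
apply: le_trans (lerD (mix x) (mix x')) _.
have e2 : 2 <= expR 1 :> R by have := expR_ge1Dx (1 : R); lra.
have : (2 * expR 1)^-1 <= 4^-1 :> R.
  by rewrite lef_pV2 ?posrE ?mulr_gt0 ?expR_gt0 //; lra.
lra.
Qed.

(** Cauchy-Schwarz for weights of mass at most [m], from expanding the weighted square about
    [s / m]. The value [m = 1/2] is how laziness is exploited later. *)
Lemma sqr_wsum_le (R : realType) (I : finType) (p a : I -> R) (m : R) :
  0 < m -> (forall i, 0 <= p i) -> \sum_i p i <= m ->
  (\sum_i p i * a i) ^+ 2 <= m * \sum_i p i * a i ^+ 2.
Proof.
move=> m0 p0 pm; set s := \sum_i p i * a i.
have : 0 <= \sum_i p i * (a i - s / m) ^+ 2.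
  by apply: sumr_ge0 => i _; rewrite mulr_ge0 ?sqr_ge0.
have -> : \sum_i p i * (a i - s / m) ^+ 2 =
    \sum_i p i * a i ^+ 2 - 2 * (s / m) * s + (s / m) ^+ 2 * \sum_i p i.
  rewrite [2 * _ * s]mulr_sumr [_ ^+ 2 * _]mulr_sumr -sumrB -big_split /=.
  by apply: eq_bigr => i _; ring.
have : (s / m) ^+ 2 * \sum_i p i <= (s / m) ^+ 2 * m by rewrite ler_wpM2l ?sqr_ge0.
have -> : (s / m) ^+ 2 * m = s ^+ 2 / m by field; rewrite gt_eqF.
have -> : 2 * (s / m) * s = 2 * (s ^+ 2 / m) by field; rewrite gt_eqF.
move=> h1 h2; rewrite mulrC -ler_pdivrMr //; lra.
Qed.

(** * Displacement of lazy reversible chains *)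

(* The conjugate [W P W^-1] of a lazy reversible kernel is a contraction of
   L2(p) up to order eps^2: writing [W x * (P u) x = g x - l x + a x] with
   [g = W * u] and [l] the Dirichlet part, laziness gives |l|^2 <= <g, l>, and
   the first order term <g, a> is of order eps^2 by symmetrisation. *)
Lemma weighted_contraction (R : realType) (T : finType) (P : T -> T -> R)
    (p W u : T -> R) (eps : R) :
  stochastic P -> (forall x, 0 <= p x) ->
  (forall x y, p x * P x y = p y * P y x) ->
  (forall x, 2^-1 <= P x x) -> (forall x, 0 < W x) ->
  (forall x y, P x y != 0 -> `|W x / W y - 1| <= eps) ->
  \sum_x p x * (W x * expect (P x) u) ^+ 2 <=
    (1 + 3 * eps ^+ 2) * \sum_x p x * (W x * u x) ^+ 2.
Proof.
move=> [P0 P1] p0 rev lazy W0 Weps.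
pose g x := W x * u x; pose S := \sum_x p x * g x ^+ 2.
pose l x := \sum_y P x y * (g x - g y).
pose r x y := W x / W y - 1.
pose a x := \sum_y P x y * (r x y * g y).
have Wn0 x : W x != 0 by rewrite gt_eqF.
have dec x : W x * expect (P x) u = g x - l x + a x.
  have -> : l x = g x - \sum_y P x y * g y.
    by rewrite /l; under eq_bigr do rewrite mulrBr; rewrite sumrB -mulr_suml P1 mul1r.
  rewrite subKr -big_split /= mulr_sumr.
  by apply: eq_bigr => y _; rewrite /r /g; field.
(* Stationarity of [p], a consequence of reversibility. *)
have sumP (h : T -> R) : \sum_x p x * \sum_y P x y * h y = \sum_x p x * h x.
  under eq_bigr do rewrite mulr_sumr.
  rewrite exchange_big /=; apply: eq_bigr => y _.
  under eq_bigr do rewrite mulrA rev -mulrA mulrCA.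
  by rewrite -mulr_suml P1 mul1r.
have reps x y : P x y != 0 -> r x y ^+ 2 <= eps ^+ 2.
  move=> /Weps h; rewrite -(real_normK (num_real (r x y))).
  by rewrite lerXn2r ?nnegrE // (le_trans _ h).
have symm x y : P x y != 0 -> p x != 0 -> P y x != 0.
  move=> Pxy px; apply: contraNneq Pxy => Pyx.
  by have := rev x y; rewrite Pyx mulr0 => /eqP; rewrite mulf_eq0 (negbTE px).
have hl : \sum_x p x * l x ^+ 2 <= \sum_x p x * (g x * l x).
  (* Exchanging [x] and [y] and averaging turns <g, l> into half the sum of squared differences. *)
  have -> : \sum_x p x * (g x * l x) =
      \sum_x p x * (2^-1 * \sum_y P x y * (g x - g y) ^+ 2).
    have -> : \sum_x p x * (g x * l x) =
        \sum_x \sum_y (p x * P x y) * (g x * (g x - g y)).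
      by apply: eq_bigr => x _; rewrite /l !mulr_sumr; apply: eq_bigr => y _; ring.
    have eqs : \sum_x \sum_y (p x * P x y) * (g x * (g x - g y)) =
        \sum_x \sum_y (p x * P x y) * (g y * (g y - g x)).
      rewrite exchange_big /=; apply: eq_bigr => x _; apply: eq_bigr => y _.
      by rewrite -rev.
    apply: (@mulfI _ 2); first by rewrite pnatr_eq0.
    rewrite mulr_natl mulr2n {2}eqs -big_split /= mulr_sumr; apply: eq_bigr => x _.
    rewrite -big_split /= !mulr_sumr; apply: eq_bigr => y _.
    by field.
  apply: ler_sum => x _; rewrite ler_wpM2l // /l.
  (* The diagonal term vanishes, so [P x x] can be replaced by 0; by laziness the remaining mass is
     at most 1/2, which supplies the factor 1/2 of the Dirichlet form. *)
  have E (h : R -> R) : h 0 = 0 -> \sum_y P x y * h (g x - g y) =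
      \sum_y (if y == x then 0 else P x y) * h (g x - g y).
    move=> h0; apply: eq_bigr => y _; case: eqP => // ->.
    by rewrite subrr h0 mulr0 mul0r.
  rewrite (E id) // (E (fun z => z ^+ 2)) ?expr0n //.
  apply: sqr_wsum_le; first by rewrite invr_gt0 ltr0n.
    by move=> y; case: ifP.
  rewrite (bigD1 x) //= eqxx add0r.
  have -> : \sum_(y | y != x) (if y == x then 0 else P x y) = 1 - P x x.
    rewrite -(P1 x) [in RHS](bigD1 x) //= [RHS]addrC addKr.
    by apply: eq_bigr => y /negbTE ->.
  by have := lazy x; lra.
have ha : \sum_x p x * a x ^+ 2 <= eps ^+ 2 * S.
  rewrite /S -(sumP (fun y => g y ^+ 2)) mulr_sumr; apply: ler_sum => x _.
  rewrite [leRHS]mulrCA ler_wpM2l //.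
  apply: (@le_trans _ _ (1 * \sum_y P x y * (r x y * g y) ^+ 2)).
    by apply: sqr_wsum_le => //; rewrite P1.
  rewrite mul1r mulr_sumr; apply: ler_sum => y _; rewrite [leRHS]mulrCA.
  have [->|/reps h] := eqVneq (P x y) 0; first by rewrite !mul0r.
  by rewrite ler_wpM2l // exprMn ler_wpM2r ?sqr_ge0.
have hg : 2 * \sum_x p x * (g x * a x) <= eps ^+ 2 * S.
  have -> : \sum_x p x * (g x * a x) = \sum_x \sum_y (p x * P x y) * (r x y * (g x * g y)).
    by apply: eq_bigr => x _; rewrite /a !mulr_sumr; apply: eq_bigr => y _; ring.
  rewrite mulr_natl mulr2n {2}exchange_big /= -big_split /=.
  have -> : eps ^+ 2 * S =
      \sum_x \sum_y (p x * P x y) * (eps ^+ 2 * (2^-1 * (g x ^+ 2 + g y ^+ 2))).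
    transitivity (eps ^+ 2 * (2^-1 * (S + S))); first by field.
    rewrite {2}/S -(sumP (fun y => g y ^+ 2)) /S -big_split /= !mulr_sumr.
    apply: eq_bigr => x _; rewrite -[p x * g x ^+ 2]mulr1 -(P1 x).
    rewrite !mulr_sumr -big_split /= !mulr_sumr; apply: eq_bigr => y _; ring.
  apply: ler_sum => x _; rewrite -big_split /=; apply: ler_sum => y _.
  rewrite -(rev x y) -mulrDr.
  have [->|pP] := eqVneq (p x * P x y) 0; first by rewrite !mul0r.
  rewrite ler_wpM2l ?mulr_ge0 //.
  move: pP; rewrite mulf_eq0 negb_or => /andP[px Pxy].
  have Pyx := symm _ _ Pxy px.
  rewrite [g y * g x]mulrC -mulrDl.
  (* Since (1 + r x y)(1 + r y x) = 1, the first-order terms cancel after symmetrisation and only a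
     product of size eps^2 survives. *)
  have -> : r x y + r y x = - (r x y * r y x) by rewrite /r; field; rewrite !Wn0.
  apply: le_trans (ler_norm _) _; rewrite normrM ler_pM //.
    rewrite normrN normrM expr2 ler_pM //; exact: Weps.
  rewrite ler_norml; have := sqr_ge0 (g x - g y); have := sqr_ge0 (g x + g y).
  rewrite !expr2; lra.
(* Adding the square (l + a)^2 removes the cross term in [l * a]. Then [hl] makes the terms in [l]
   nonpositive, while [hg] and [ha] contribute 1 and 2 to the constant 3. *)
apply: (@le_trans _ _ (S - 2 * \sum_x p x * (g x * l x) + 2 * \sum_x p x * l x ^+ 2
   + 2 * \sum_x p x * (g x * a x) + 2 * \sum_x p x * a x ^+ 2)).
  rewrite /S !mulr_sumr -sumrB -!big_split /=; apply: ler_sum => x _.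
  rewrite dec.
  have -> : p x * g x ^+ 2 - 2 * (p x * (g x * l x)) + 2 * (p x * l x ^+ 2) +
      2 * (p x * (g x * a x)) + 2 * (p x * a x ^+ 2) =
      p x * (g x - l x + a x) ^+ 2 + p x * (l x + a x) ^+ 2 by ring.
  by rewrite lerDl mulr_ge0 ?sqr_ge0.
have -> : \sum_x p x * (W x * u x) ^+ 2 = S by [].
lra.
Qed.

Lemma expR_lipschitz (R : realType) (alpha d : R) :
  0 <= alpha <= 2^-1 -> `|d| <= 1 -> `|expR (alpha * d) - 1| <= 2 * alpha.
Proof.
move=> /andP[a0 a2]; rewrite !ler_norml => /andP[d0 d1].
have h1 : alpha * d <= alpha by rewrite ler_piMr.
have h2 : - alpha <= alpha * d by rewrite -mulrN1 ler_wpM2l.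
have h3 := expR_ge1Dx (alpha * d).
have : expR (alpha * d) * (1 - alpha) <= 1.
  rewrite -[leRHS](expRxMexpNx_1 (alpha * d)) ler_pM2l ?expR_gt0 //.
  by have := expR_ge1Dx (- (alpha * d)); lra.
move=> he; suff h4 : expR (alpha * d) <= 1 + 2 * alpha by apply/andP; split; lra.
have a1 : 0 < 1 - alpha by lra.
by rewrite -(ler_pM2r a1) (le_trans he) //; nra.
Qed.

(** By reversibility the density [u s] of the law with respect to [p] evolves under [P] itself. Its
    weighted square norm starts at [1 / p x0] because [D x0 = 0], and [weighted_contraction] with
    [eps = 2 * alpha] controls each step. Cauchy-Schwarz then passes to the expectation. *)
Lemma expect_expR_bound (R : realType) (T : finType) (P : T -> T -> R) (p D : T -> R)
    (x0 : T) (alpha : R) (t : nat) :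
  stochastic P -> (forall x, 0 < p x) -> \sum_x p x = 1 ->
  (forall x y, p x * P x y = p y * P y x) ->
  (forall x, 2^-1 <= P x x) -> D x0 = 0 ->
  (forall x y, P x y != 0 -> `|D x - D y| <= 1) ->
  0 <= alpha <= 2^-1 ->
  expect (law P t x0) (fun x => expR (alpha * D x)) ^+ 2 <=
    (1 + 12 * alpha ^+ 2) ^+ t / p x0.
Proof.
move=> sP p0 p1 rev lazy D0 DL ha.
pose W x := expR (alpha * D x); pose u s y := law P s x0 y / p y.
have pn0 x : p x != 0 by rewrite gt_eqF.
have uS s y : expect (P y) (u s) = u s.+1 y.
  rewrite /u /expect /= mulr_suml; apply: eq_bigr => z _.
  have -> : P y z = p z * P z y / p y by rewrite -rev mulrAC mulfV // mul1r.
  by field; rewrite !pn0.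
have N s : \sum_x p x * (W x * u s x) ^+ 2 <= (1 + 12 * alpha ^+ 2) ^+ s / p x0.
  elim: s => [|s IH].
    rewrite (bigD1 x0) //= big1 ?addr0 => [|x /negbTE xx0].
      rewrite /W /u /= D0 mulr0 expR0 eqxx expr0 mulr1n.
      by rewrite le_eqVlt; apply/orP; left; apply/eqP; field; rewrite pn0.
    by rewrite /u /= xx0 mul0r mulr0 expr0n mulr0.
  under eq_bigr do rewrite -uS.
  apply: le_trans (weighted_contraction (eps := 2 * alpha) _ sP _ rev lazy _ _) _.
  - by move=> x; apply: ltW.
  - by move=> x; apply: expR_gt0.
  - move=> x y Pxy; rewrite /W -expRB -mulrBr; apply: expR_lipschitz => //.
    exact: DL.
  have -> : 1 + 3 * (2 * alpha) ^+ 2 = 1 + 12 * alpha ^+ 2 by ring.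
  rewrite [_ ^+ s.+1]exprS -[leRHS]mulrA ler_wpM2l // addr_ge0 // mulr_ge0 ?sqr_ge0 //.
apply: le_trans (N t).
have -> : expect (law P t x0) (fun x => expR (alpha * D x)) = \sum_x p x * (W x * u t x).
  by apply: eq_bigr => x _; rewrite /u /W; field.
rewrite -[leRHS]mul1r; apply: sqr_wsum_le => //; last by rewrite p1.
by move=> x; apply: ltW.
Qed.

(* Up to constants, a lazy reversible chain needs L = log (1 / p x0) << D^2 / t
   to have travelled a distance D from x0. *)
Lemma expect_displacement (R : realType) (T : finType) (P : T -> T -> R) (p D : T -> R)
    (x0 : T) (alpha L : R) (t : nat) :
  stochastic P -> (forall x, 0 < p x) -> \sum_x p x = 1 ->
  (forall x y, p x * P x y = p y * P y x) ->
  (forall x, 2^-1 <= P x x) -> D x0 = 0 ->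
  (forall x y, P x y != 0 -> `|D x - D y| <= 1) ->
  0 <= alpha <= 2^-1 -> expR (- L) <= p x0 ->
  2 * alpha * expect (law P t x0) D <= 12 * alpha ^+ 2 * t%:R + L.
Proof.
move=> sP p0 p1 rev lazy D0 DL ha hL.
have := expect_expR_bound t sP p0 p1 rev lazy D0 DL ha.
set E := expect _ _ => hE; set m := expect _ D.
(* Jensen's inequality, via the tangent line of the exponential at the mean [m]. *)
have mE : expR (alpha * m) <= E.
  have -> : expR (alpha * m) =
      expect (law P t x0) (fun x => expR (alpha * m) * (1 + alpha * (D x - m))).
    rewrite /expect; under eq_bigr => x _.
      have -> : law P t x0 x * (expR (alpha * m) * (1 + alpha * (D x - m))) =
        (1 - alpha * m) * expR (alpha * m) * law P t x0 x +
        alpha * expR (alpha * m) * (law P t x0 x * D x) by ring.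
      over.
    rewrite big_split /= -!mulr_sumr law_sum1 // -/(expect _ D) -/m; ring.
  apply: ler_sum => x _; rewrite ler_wpM2l ?law_ge0 //.
  have -> : alpha * D x = alpha * m + alpha * (D x - m) by ring.
  by rewrite expRD ler_pM2l ?expR_gt0 // expR_ge1Dx.
rewrite -ler_expR.
apply: (@le_trans _ _ (E ^+ 2)).
  have -> : 2 * alpha * m = 2%:R * (alpha * m) by ring.
  by rewrite expRM_natl lerXn2r ?nnegrE ?expR_ge0 // (le_trans _ mE) ?expR_ge0.
apply: le_trans hE _; rewrite expRD expRM_natr.
apply: ler_pM.
- by rewrite exprn_ge0 // addr_ge0 // mulr_ge0 ?sqr_ge0.
- by rewrite invr_ge0 ltW.
- rewrite lerXn2r ?nnegrE ?expR_ge0 ?expR_ge1Dx //.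
  by rewrite addr_ge0 // mulr_ge0 ?sqr_ge0.
by rewrite -[expR L]invrK -expRN lef_pV2 ?posrE ?expR_gt0.
Qed.

(** * The solid-on-solid measure *)

Lemma geometric_sum_le (R : realType) (r : R) (n : nat) :
  0 <= r < 1 -> \sum_(i < n) r ^+ i <= (1 - r)^-1.
Proof.
move=> /andP[r0 r1]; have d0 : 0 < 1 - r by rewrite subr_gt0.
rewrite -[leRHS]mul1r ler_pdivlMr //.
have := subrX1 r n; have := exprn_ge0 n r0; lra.
Qed.

Lemma ht_ord (n : nat) (eta : config n) (i : 'I_n) : ht eta i.+1 = eta i.
Proof. by rewrite /ht /= (valK i). Qed.

Lemma ht_out (n : nat) (eta : config n) : ht eta n.+1 = 0%N.
Proof. by rewrite /ht /= insubF ?ltnn. Qed.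

Lemma ht_le (n : nat) (eta : config n) k : (ht eta k <= n)%N.
Proof.
rewrite /ht; case: ifP => // _; case: insub => // i.
by rewrite -ltnS; apply: ltn_ord.
Qed.

Lemma ht_upd (n : nat) (eta : config n) (i : 'I_n) (j : 'I_n.+1) k :
  ht (upd eta i j) k = if k == i.+1 then val j else ht eta k.
Proof.
rewrite /ht; case: k => [|k] //=; rewrite eqSS.
case: insubP => [k' kn /= vk|kn]; last by case: eqP => // ki; rewrite ki ltn_ord in kn.
by rewrite ffunE -val_eqE /= vk; case: ifP.
Qed.

Lemma upd_id (n : nat) (eta : config n) (i : 'I_n) : upd eta i (eta i) = eta.
Proof. by apply/ffunP => k; rewrite ffunE; case: eqP => // ->. Qed.

Lemma Hsos_upd (n : nat) (eta : config n) (i : 'I_n) :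
  exists r, forall j : 'I_n.+1, Hsos (upd eta i j) =
    (absdiff (ht eta i) j + absdiff j (ht eta i.+2) + r)%N.
Proof.
pose i0 : 'I_n.+1 := widen_ord (leqnSn n) i; pose i1 : 'I_n.+1 := lift ord0 i.
exists (\sum_(k < n.+1 | (k != i0) && (k != i1)) absdiff (ht eta k) (ht eta k.+1))%N.
move=> j; rewrite /Hsos (bigD1 i0) //= (bigD1 i1) /=; last first.
  by rewrite -val_eqE /= /bump /= add1n; apply/eqP; lia.
rewrite !ht_upd /bump /= !add1n !eqxx; case: eqP => [|_]; first lia.
case: eqP => [|_]; first lia.
rewrite addnA; congr addn; apply: eq_bigr => k /andP[k0 k1]; rewrite !ht_upd.
move: k0 k1; rewrite -!val_eqE /= /bump /= add1n eqSS => /negbTE -> /negbTE ->.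
by [].
Qed.

Lemma weight_gt0 (R : realType) (beta : R) (n : nat) (eta : config n) : 0 < weight beta eta.
Proof. exact: expR_gt0. Qed.

Definition partition_function (R : realType) (beta : R) (n : nat) : R :=
  \sum_(x : config n) weight beta x.

Lemma partition_function_gt0 (R : realType) (beta : R) (n : nat) :
  0 < partition_function beta n.
Proof.
rewrite /partition_function (bigD1 [ffun=> ord0]) //= ltr_pwDl ?weight_gt0 //.
by apply: sumr_ge0 => x _; apply/ltW/weight_gt0.
Qed.

Lemma mu_gt0 (R : realType) (beta : R) (n : nat) (eta : config n) : 0 < mu beta eta.
Proof. by rewrite divr_gt0 ?weight_gt0 ?partition_function_gt0. Qed.

Lemma mu_sum1 (R : realType) (beta : R) (n : nat) : \sum_(x : config n) mu beta x = 1.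
Proof. by rewrite /mu -mulr_suml divff // gt_eqF ?partition_function_gt0. Qed.

Lemma mu_upd (R : realType) (beta : R) (n : nat) (eta : config n) (i : 'I_n) :
  exists c : R, 0 < c /\ forall j : 'I_n.+1, mu beta (upd eta i j) =
    c * expR (- beta * (absdiff (ht eta i) j + absdiff j (ht eta i.+2))%N%:R).
Proof.
have [r Hr] := Hsos_upd eta i.
exists (expR (- beta * r%:R) / partition_function beta n).
split=> [|j]; first by rewrite divr_gt0 ?expR_gt0 ?partition_function_gt0.
by rewrite /mu /weight Hr natrD mulrDr expRD -/(partition_function _ _); ring.
Qed.

(* A configuration is determined by its increments, whose joint weight
   dominates its own. *)
Lemma partition_function_le (R : realType) (beta : R) (n : nat) :
  0 < beta -> partition_function beta n <= (2 / (1 - expR (- beta))) ^+ n.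
Proof.
move=> b0; pose r := expR (- beta).
have r01 : 0 <= r < 1 by rewrite expR_ge0 expR_lt1 oppr_lt0.
pose G (p : 'I_n.+1 * bool) := r ^+ p.1.
(* An increment is stored as its size and its sign; starting from height 0 at the left end, these
   recover every height. Summing over a sign gives the factor 2, over a size a geometric series. *)
pose xi (eta : config n) : {ffun 'I_n -> 'I_n.+1 * bool} :=
  [ffun i : 'I_n => (inord (absdiff (ht eta i) (ht eta i.+1)), (ht eta i <= ht eta i.+1)%N)].
have xiv eta (i : 'I_n) : (xi eta i).1 = absdiff (ht eta i) (ht eta i.+1) :> nat.
  rewrite ffunE /= inordK // ltnS /absdiff.
  have := ht_le eta i; have := ht_le eta i.+1; lia.
have inj : injective xi.
  move=> e1 e2 e12.
  have E k : (k <= n)%N -> ht e1 k = ht e2 k.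
    elim: k => [|k IH] kn; first by rewrite /ht.
    have := xiv e1 (Ordinal kn); have := xiv e2 (Ordinal kn); rewrite -e12.
    move=> ->; rewrite /absdiff /=.
    have := congr1 (fun f : {ffun 'I_n -> 'I_n.+1 * bool} => (f (Ordinal kn)).2) e12.
    rewrite !ffunE /= (IH (ltnW kn)) => E.
    have : (ht e2 k <= ht e1 k.+1)%N <-> (ht e2 k <= ht e2 k.+1)%N by rewrite E.
    lia.
  by apply/ffunP => i; apply/val_inj; rewrite /= -!ht_ord E.
have -> : (2 / (1 - expR (- beta))) ^+ n = \prod_(i < n) (2 / (1 - r)).
  by rewrite prodr_const card_ord.
apply: (@le_trans _ _ (\prod_(i < n) \sum_p G p)); last first.
  apply: ler_prod => i _; apply/andP; split.
    by apply: sumr_ge0 => p _; rewrite exprn_ge0 ?expR_ge0.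
  rewrite -(pair_bigA _ (fun k (_ : bool) => r ^+ (k : 'I_n.+1))) /=.
  under eq_bigr do rewrite sumr_const card_bool -mulr_natl.
  by rewrite -mulr_sumr ler_wpM2l // geometric_sum_le.
rewrite bigA_distr_bigA /=.
apply: (@le_trans _ _ (\sum_eta \prod_(i < n) G (xi eta i))).
  (* The last edge, back to height 0 at position n + 1, is split off and its factor bounded by 1. *)
  apply: ler_sum => eta _; rewrite /weight expRM_natr -/r /Hsos big_ord_recr /= exprD.
  rewrite -[leRHS]mulr1 ler_pM ?exprn_ge0 ?expR_ge0 //; last first.
    by rewrite exprn_ile1 ?expR_ge0 // expR_le1 oppr_le0 ltW.
  rewrite -prodrXr le_eqVlt; apply/orP; left; apply/eqP; apply: eq_bigr => i _.
  by rewrite /G xiv.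
rewrite -(big_imset (h := xi) (A := predT) (fun f : {ffun _} => \prod_(i < n) G (f i))) /=;
  last by move=> x y _ _; apply: inj.
rewrite [leRHS](bigID (mem [set xi x | x in predT])) /= lerDl.
apply: sumr_ge0 => f _; apply: prodr_ge0 => i _; rewrite exprn_ge0 ?expR_ge0 //.
Qed.

Definition flat (n : nat) (j : 'I_n.+1) : config n := [ffun=> j].

(** A flat configuration pays only at its two ends, at most 2n in energy, while the partition
    function is at most c^n with c <= e^c. This makes the entropy cost [L] linear in [n]. *)
Lemma mu_flat_ge (R : realType) (beta : R) (n : nat) (j : 'I_n.+1) : 0 < beta ->
  expR (- ((2 * beta + 2 / (1 - expR (- beta))) * n%:R)) <= mu beta (flat j).
Proof.
move=> b0; have c0 : 0 < 2 / (1 - expR (- beta)).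
  by rewrite divr_gt0 // subr_gt0 expR_lt1 oppr_lt0.
rewrite mulrDl opprD expRD ler_pM ?expR_ge0 //.
  rewrite ler_expR mulNr lerN2.
  have H : (Hsos (flat j) <= 2 * n)%N.
    apply: (@leq_trans (\sum_(k < n.+1) ((k == 0 :> nat) * n + (k == n :> nat) * n))%N).
      apply: leq_sum => k _; have h1 := ht_le (flat j) k; have h2 := ht_le (flat j) k.+1.
      rewrite /absdiff; case: (posnP k) => [k0|k0].
        have -> : ht (flat j) k = 0%N by rewrite k0.
        by rewrite mul1n sub0n add0n subn0 (leq_trans h2) ?leq_addr.
      case: (ltngtP k n) => [kn|kn|kn].
      - have hk1 : (k.-1 < n)%N by lia.
        have -> : ht (flat j) k = j.
          by rewrite -(prednK k0) (ht_ord _ (Ordinal hk1)) ffunE.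
        by rewrite (ht_ord _ (Ordinal kn)) ffunE subnn.
      - by have := ltn_ord k; lia.
      - by rewrite mul1n kn ht_out subn0 sub0n addn0 (leq_trans (ht_le _ _)) ?leq_addl.
    rewrite big_split /= -!big_distrl /= -mulnDl leq_mul2r; apply/orP; right.
    rewrite (bigD1 ord0) //= big1 ?addn0; last first.
      by move=> k /negbTE k0; move: k0; rewrite -val_eqE /= => ->.
    rewrite (bigD1 ord_max) //= eqxx big1 // => k /negbTE.
    by rewrite -val_eqE /= => ->.
  have : (Hsos (flat j))%:R <= (2 * n)%:R :> R by rewrite ler_nat.
  by move=> /(ler_wpM2l (ltW b0)); rewrite natrM mulrCA mulrA.
rewrite [expR (- (_ * _))]expRN lef_pV2 ?posrE ?expR_gt0 ?partition_function_gt0 //.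
apply: le_trans (partition_function_le _ b0) _.
rewrite expRM_natr lerXn2r ?nnegrE ?expR_ge0 ?(ltW c0) //.
by have := expR_ge1Dx (2 / (1 - expR (- beta))); lra.
Qed.

(** * Single-site dynamics *)

Lemma updE (n : nat) (eta : config n) (i : 'I_n) (j : 'I_n.+1) : upd eta i j i = j.
Proof. by rewrite ffunE eqxx. Qed.

Lemma upd_upd (n : nat) (eta : config n) (i : 'I_n) (j j' : 'I_n.+1) :
  upd (upd eta i j) i j' = upd eta i j'.
Proof. by apply/ffunP => k; rewrite !ffunE; case: eqP. Qed.

Lemma down_val (n : nat) (eta : config n) (i : 'I_n) : down eta i i = (eta i).-1 :> nat.
Proof. by rewrite updE inordK // (leq_ltn_trans (leq_pred _) (ltn_ord _)). Qed.

Lemma up_val (n : nat) (eta : config n) (i : 'I_n) : up eta i i = minn (eta i).+1 n :> nat.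
Proof. by rewrite updE inordK // ltnS geq_minr. Qed.

Lemma upd_eq (n : nat) (eta : config n) (i : 'I_n) (j : 'I_n.+1) :
  j = eta i :> nat -> upd eta i j = eta.
Proof. by move=> /val_inj ->; apply: upd_id. Qed.

Lemma down_neq (n : nat) (eta : config n) (i : 'I_n) : down eta i != eta -> (0 < eta i)%N.
Proof.
apply: contraNT; rewrite -eqn0Ngt => /eqP e0; apply/eqP/upd_eq.
rewrite inordK; last exact: leq_ltn_trans (leq_pred _) (ltn_ord _).
by rewrite /= e0.
Qed.

Lemma up_neq (n : nat) (eta : config n) (i : 'I_n) : up eta i != eta -> (eta i < n)%N.
Proof.
apply: contraNT; rewrite -leqNgt => e0; apply/eqP/upd_eq.
by rewrite inordK ?ltnS ?geq_minr //=; have := ltn_ord (eta i); lia.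
Qed.

(** Truncation at the floor destroys invertibility only for a move that changes nothing, which the
    hypothesis excludes. *)
Lemma up_down (n : nat) (eta : config n) (i : 'I_n) :
  down eta i != eta -> up (down eta i) i = eta.
Proof.
move=> /down_neq e0; rewrite /up {1}/down upd_upd; apply: upd_eq.
by rewrite inordK ?ltnS ?geq_minr //= down_val; have := ltn_ord (eta i); lia.
Qed.

Lemma down_up (n : nat) (eta : config n) (i : 'I_n) :
  up eta i != eta -> down (up eta i) i = eta.
Proof.
move=> /up_neq e0; rewrite /down {1}/up upd_upd; apply: upd_eq.
by rewrite inordK /= up_val; have := ltn_ord (eta i); lia.
Qed.

Lemma p_minus_bounds (R : realType) (beta : R) (n : nat) (eta : config n) (i : 'I_n) :
  0 < beta -> 0 <= p_minus beta eta i <= 4^-1.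
Proof.
move=> b0; have h1 : expR (- (2 * beta)) <= 1 by rewrite expR_le1; lra.
have h2 := expR_ge0 (- (2 * beta)); rewrite /p_minus; case: ifP => _; lra.
Qed.

Lemma p_plus_bounds (R : realType) (beta : R) (n : nat) (eta : config n) (i : 'I_n) :
  0 < beta -> 0 <= p_plus beta eta i <= 4^-1.
Proof.
move=> b0; have h1 : expR (- (2 * beta)) <= 1 by rewrite expR_le1; lra.
have h2 := expR_ge0 (- (2 * beta)); rewrite /p_plus; case: ifP => _; lra.
Qed.

(** Detailed balance for one step from h + 1 to h. The energy changes by +2, 0 or -2; the factor
    [expR (- (2 * beta))] sits in [p_minus] in the first case and in [p_plus] of the lowered
    configuration in the last. *)
Lemma mu_down (R : realType) (beta : R) (n : nat) (eta : config n) (i : 'I_n) :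
  (0 < eta i)%N ->
  mu beta eta * p_minus beta eta i = mu beta (down eta i) * p_plus beta (down eta i) i.
Proof.
move=> e0; have [c [_ Hc]] := mu_upd beta eta i.
rewrite -{1}(upd_id eta i) {1}/down !Hc /p_minus /p_plus /= down_val !ht_upd.
rewrite (_ : (i : nat) == i.+1 = false); last by apply/eqP; lia.
rewrite (_ : i.+2 == i.+1 = false); last by apply/eqP; lia.
rewrite inordK; last exact: leq_ltn_trans (leq_pred _) (ltn_ord _).
set a := ht eta i; set b := ht eta i.+2; case: (nat_of_ord (eta i)) e0 => // h _ /=.
have E (m k : nat) : m = (k + 2)%N -> expR (- beta * m%:R) =
    expR (- beta * k%:R) * expR (- (2 * beta)) :> R.
  by move=> ->; rewrite natrD -expRD; congr expR; ring.
have Esym (m k : nat) : m = k -> expR (- beta * m%:R) = expR (- beta * k%:R) :> R.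
  by move=> ->.
rewrite -!mulrA; congr (_ * _).
case: leqP => h1; case: leqP => h2.
- by rewrite (E _ (absdiff a h + absdiff h b)%N) ?mul1r ?mulrA //; rewrite /absdiff; lia.
- by rewrite (Esym _ (absdiff a h + absdiff h b)%N) //; rewrite /absdiff; lia.
- by exfalso; lia.
- rewrite (E (absdiff a h + absdiff h b)%N (absdiff a h.+1 + absdiff h.+1 b)%N).
    by rewrite mul1r mulrA.
  by rewrite /absdiff; lia.
Qed.

Definition single_site_kernel (R : realType) (beta : R) (n : nat) (i : 'I_n)
    (eta eta' : config n) : R :=
  p_minus beta eta i * (eta' == down eta i)%:R
  + p_plus beta eta i * (eta' == up eta i)%:R
  + (1 - p_minus beta eta i - p_plus beta eta i) * (eta' == eta)%:R.

(** Off the diagonal, a down move from one configuration is the reverse of an up move from the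
    other, so [mu_down] matches the two halves crosswise. *)
Lemma single_site_kernel_reversible (R : realType) (beta : R) (n : nat) (i : 'I_n)
    (x y : config n) :
  mu beta x * single_site_kernel beta i x y = mu beta y * single_site_kernel beta i y x.
Proof.
have [->//|xy] := eqVneq x y.
have half (u v : config n) : u != v -> mu beta u * (p_minus beta u i * (v == down u i)%:R) =
    mu beta v * (p_plus beta v i * (u == up v i)%:R).
  move=> uv; have [vd|vd] := eqVneq v (down u i).
    have du : down u i != u by rewrite -vd eq_sym.
    by rewrite vd (up_down du) eqxx !mulr1 mu_down // down_neq.
  have [ud|_] := eqVneq u (up v i); last by rewrite !mulr0.
  by case/eqP: vd; rewrite ud down_up // -ud.
rewrite /single_site_kernel [y == x]eq_sym (negbTE xy) !mulr0 !addr0 !mulrDr half //.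
by rewrite [X in _ = X + _]half 1?eq_sym // addrC.
Qed.

Lemma single_site_kernel_ge0 (R : realType) (beta : R) (n : nat) (i : 'I_n)
    (x y : config n) : 0 < beta -> 0 <= single_site_kernel beta i x y.
Proof.
move=> b0; have := p_minus_bounds x i b0; have := p_plus_bounds x i b0 => h1 h2.
by rewrite !addr_ge0 // mulr_ge0 //; lra.
Qed.

Lemma sum_indicator (R : realType) (T : finType) (x : T) : \sum_y (y == x)%:R = 1 :> R.
Proof. by rewrite (bigD1 x) //= eqxx big1 ?addr0 // => y /negbTE ->. Qed.

Lemma invr_sum_const (R : realType) (n : nat) (c : R) :
  (0 < n)%N -> n%:R^-1 * \sum_(i < n) c = c.
Proof.
move=> n0; rewrite sumr_const card_ord -[c *+ n]mulr_natl mulrA mulVf ?mul1r //.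
by rewrite pnatr_eq0 -lt0n.
Qed.

Lemma Pss_stochastic (R : realType) (beta : R) (n : nat) :
  0 < beta -> (0 < n)%N -> stochastic (@Pss R beta n).
Proof.
move=> b0 n0; split=> [x y|x].
  rewrite mulr_ge0 ?invr_ge0 //; apply: sumr_ge0 => i _.
  exact: single_site_kernel_ge0.
rewrite /Pss -mulr_sumr exchange_big /= -[RHS](invr_sum_const 1 n0); congr (_ * _).
apply: eq_bigr => i _; rewrite !big_split /= -!mulr_sumr !sum_indicator; ring.
Qed.

Lemma Pss_reversible (R : realType) (beta : R) (n : nat) (x y : config n) :
  mu beta x * Pss beta x y = mu beta y * Pss beta y x.
Proof.
rewrite /Pss mulrCA [RHS]mulrCA; congr (_ * _); rewrite !mulr_sumr.
apply: eq_bigr => i _; exact: single_site_kernel_reversible.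
Qed.

Lemma Pss_lazy (R : realType) (beta : R) (n : nat) (x : config n) :
  0 < beta -> (0 < n)%N -> 2^-1 <= Pss beta x x.
Proof.
move=> b0 n0; rewrite -[leLHS](invr_sum_const _ n0) ler_wpM2l ?invr_ge0 //.
apply: ler_sum => i _; have h1 := p_minus_bounds x i b0; have h2 := p_plus_bounds x i b0.
have := mulr_ge0 (andP h1).1 (ler0n R (x == down x i)).
have := mulr_ge0 (andP h2).1 (ler0n R (x == up x i)).
by rewrite eqxx mulr1; lra.
Qed.

Definition area (R : realType) (n : nat) (eta : config n) : R :=
  \sum_(i < n) (eta i)%:R.

Lemma area_upd (R : realType) (n : nat) (eta : config n) (i : 'I_n) (j : 'I_n.+1) :
  area R (upd eta i j) = area R eta - (eta i)%:R + j%:R.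
Proof.
rewrite /area (bigD1 i) //= [in RHS](bigD1 i) //= updE [RHS]addrC [_ + _ - _]addrAC subrr add0r.
by congr (_ + _); apply: eq_bigr => k /negbTE ki; rewrite ffunE ki.
Qed.

Lemma area_bounds (R : realType) (n : nat) (eta : config n) :
  0 <= area R eta <= n%:R ^+ 2.
Proof.
rewrite sumr_ge0 //=; apply: (@le_trans _ _ (\sum_(i < n) n%:R)).
  by apply: ler_sum => i _; rewrite ler_nat -ltnS.
by rewrite sumr_const card_ord -[_ *+ n]mulr_natl expr2.
Qed.

Lemma area_flat (R : realType) (n : nat) (j : 'I_n.+1) : area R (flat j) = n%:R * j%:R.
Proof.
rewrite /area; under eq_bigr do rewrite ffunE.
by rewrite sumr_const card_ord mulr_natl.
Qed.

Lemma Pss_area_lipschitz (R : realType) (beta : R) (n : nat) (x y : config n) :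
  Pss beta x y != 0 -> `|area R x - area R y| <= 1.
Proof.
have near (k l : nat) : (k <= l.+1)%N -> (l <= k.+1)%N ->
    `|area R x - (area R x - k%:R + l%:R)| <= 1 :> R.
  move=> kl lk; have : k%:R <= l%:R + 1 :> R by rewrite natr1 ler_nat.
  have : l%:R <= k%:R + 1 :> R by rewrite natr1 ler_nat.
  by move=> h1 h2; rewrite ler_norml; apply/andP; split; lra.
move=> Pxy; have [->|xy] := eqVneq y x; first by rewrite subrr normr0.
have [/existsP[i /orP[]/eqP ->]|/existsPn H] :=
    boolP [exists i, (y == down x i) || (y == up x i)].
- rewrite area_upd inordK; last exact: leq_ltn_trans (leq_pred _) (ltn_ord _).
  by apply: near => /=; lia.
- rewrite area_upd inordK ?ltnS ?geq_minr //.
  by apply: near => /=; have := ltn_ord (x i); lia.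
case/eqP: Pxy; rewrite /Pss big1 ?mulr0 // => i _.
have := H i; rewrite negb_or => /andP[/negbTE -> /negbTE ->].
by rewrite (negbTE xy) !mulr0 !addr0.
Qed.

Lemma Pss_lower_bound (R : realType) (beta : R) : 0 < beta ->
  exists c : R, 0 < c /\ exists N : nat, forall n : nat, (N <= n)%N ->
     forall t : nat, mixed_at (@Pss R beta n) (@mu R beta n) t ->
       c * (n%:R ^+ 3) <= t%:R.
Proof.
move=> b0; pose C := 2 * beta + 2 / (1 - expR (- beta)).
have C0 : 0 < C.
  by rewrite addr_gt0 ?mulr_gt0 // invr_gt0 subr_gt0 expR_lt1 oppr_lt0.
exists (192 * C)^-1; split; first by rewrite invr_gt0 mulr_gt0.
exists (Num.truncn (8 * C)).+1 => n Nn t mix.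
have n0 : (0 < n)%N by apply: leq_trans Nn.
have nR : 0 < n%:R :> R by rewrite ltr0n.
have nC : 8 * C <= n%:R.
  apply: ltW; apply: lt_le_trans (truncnS_gt _) _; by rewrite ler_nat.
have sP := Pss_stochastic b0 n0.
have move_le (j : 'I_n.+1) (D : config n -> R) : D (flat j) = 0 ->
    (forall x y, Pss beta x y != 0 -> `|D x - D y| <= 1) ->
    expect (law (@Pss R beta n) t (flat j)) D <= 24 * C * (t%:R / n%:R) + n%:R ^+ 2 / 8.
  (* With [L = C * n] this choice makes [L / (2 * alpha)] equal to n^2 / 8; the threshold n >= 8C
     ensures alpha <= 1/2. *)
  move=> D0 DL; pose alpha := 4 * C / n%:R.
  have a0 : 0 < alpha by rewrite divr_gt0 // mulr_gt0.
  have ha : 0 <= alpha <= 2^-1.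
    by rewrite (ltW a0) /alpha ler_pdivrMr //; lra.
  have := expect_displacement t sP (@mu_gt0 R beta n) (@mu_sum1 R beta n)
    (@Pss_reversible R beta n) (fun x => Pss_lazy x b0 n0) D0 DL ha (mu_flat_ge j b0).
  rewrite -/C -ler_pdivlMl; last by rewrite mulr_gt0.
  move=> h; apply: (le_trans h).
  by rewrite le_eqVlt; apply/orP; left; apply/eqP; rewrite /alpha; field; rewrite !gt_eqF.
have low : expect (law (@Pss R beta n) t (flat ord0)) (@area R n)
    <= 24 * C * (t%:R / n%:R) + n%:R ^+ 2 / 8.
  apply: move_le; first by rewrite area_flat mulr0.
  exact: Pss_area_lipschitz.
have top : expect (law (@Pss R beta n) t (flat ord_max)) (fun x => n%:R ^+ 2 - area R x)
    <= 24 * C * (t%:R / n%:R) + n%:R ^+ 2 / 8.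
  apply: move_le; first by rewrite area_flat expr2 subrr.
  move=> x y /Pss_area_lipschitz; rewrite distrC.
  by rewrite (_ : _ - _ - (_ - _) = area R y - area R x) //; ring.
have diff := mixed_expect_diff (flat ord_max) (flat ord0) sP mix (@area_bounds R n).
have Etop : expect (law (@Pss R beta n) t (flat ord_max)) (fun x => n%:R ^+ 2 - area R x) =
    n%:R ^+ 2 - expect (law (@Pss R beta n) t (flat ord_max)) (@area R n).
  rewrite /expect; under eq_bigr do rewrite mulrBr.
  by rewrite sumrB -mulr_suml law_sum1 // mul1r.
rewrite Etop in top.
(* The initial gap n^2 is at most the mixed gap n^2 / 2 plus two displacements, each n^2 / 8 plus a
   term in t / n. Solving for t yields the constant 1 / (192 C). *)
have key : n%:R ^+ 2 / 4 <= 48 * C * (t%:R / n%:R) by lra.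
rewrite mulrC ler_pdivrMr ?mulr_gt0 //.
have : n%:R ^+ 2 / 4 * n%:R <= 48 * C * (t%:R / n%:R) * n%:R by rewrite ler_wpM2r // ltW.
rewrite -[_ / _ * n%:R]mulrA -!(mulrA (48 * C)) divfK ?gt_eqF //.
by rewrite !exprS expr0; lra.
Qed.

(** * Column dynamics *)

Lemma sum_sqr_geometric_le (R : realType) (q : R) (n : nat) : 0 <= q < 1 ->
  \sum_(0 <= k < n) q ^+ k * k%:R ^+ 2 <= q * (1 + q) / (1 - q) ^+ 3.
Proof.
move=> /andP[q0 q1]; have d0 : 0 < 1 - q by rewrite subr_gt0.
(* [tail x] is the closed form of the series of q^k (x + k)^2 over k >= 0, so [q ^+ n * tail n] is
   the remainder beyond [n]. *)
pose tail (x : R) := x ^+ 2 / (1 - q) + 2 * x * q / (1 - q) ^+ 2 + q * (1 + q) / (1 - q) ^+ 3.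
have -> : \sum_(0 <= k < n) q ^+ k * k%:R ^+ 2 = tail 0 - q ^+ n * tail n%:R.
  elim: n => [|n IH]; first by rewrite big_nil expr0 mul1r subrr.
  rewrite big_nat_recr //= IH [q ^+ n.+1]exprS -natr1 /tail; field; exact: lt0r_neq0.
have : 0 <= q ^+ n * tail n%:R.
  have i k : 0 <= ((1 - q) ^+ k)^-1 by rewrite invr_ge0 exprn_ge0 // ltW.
  have i1 : 0 <= (1 - q)^-1 by rewrite invr_ge0 ltW.
  by rewrite mulr_ge0 ?exprn_ge0 // !addr_ge0 ?mulr_ge0 ?sqr_ge0 ?addr_ge0.
rewrite (_ : tail 0 = q * (1 + q) / (1 - q) ^+ 3); first lra.
by rewrite /tail expr0n /= !mulr0 !mul0r !add0r.
Qed.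

Lemma sum_nat_widen (R : realType) (F : nat -> R) (m n : nat) :
  (m <= n)%N -> (forall k, (m <= k)%N -> 0 <= F k) ->
  \sum_(0 <= k < m) F k <= \sum_(0 <= k < n) F k.
Proof.
move=> mn F0; rewrite [leRHS](@big_cat_nat _ _ _ m) //= lerDl big_nat_cond.
by apply: sumr_ge0 => k /andP[/andP[mk _] _]; apply: F0.
Qed.

(** The base point [x] drops out, leaving a convexity gain of order d^3 / 6. *)
Lemma sum_sqr_interval (R : realType) (x : R) (d : nat) :
  \sum_(0 <= k < d.+1) ((x + k%:R) ^+ 2 - (x ^+ 2 + (x + d%:R) ^+ 2) / 2) =
  (d%:R + 1) * (d%:R - d%:R ^+ 2) / 6.
Proof.
have E m : \sum_(0 <= k < m) (x + k%:R) ^+ 2 =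
    m%:R * x ^+ 2 + x * (m%:R * (m%:R - 1)) + (m%:R - 1) * m%:R * (2 * m%:R - 1) / 6.
  elim: m => [|m IH]; first by rewrite big_nil; field.
  by rewrite big_nat_recr //= IH -natr1; field.
by rewrite sumrB E sumr_const_nat subn0 -mulr_natl -natr1; field.
Qed.

(* The two geometric tails are matched term by term, so that the linear terms
   cancel up to a multiple of (1 + d)^2, d = B - A; this is absorbed by the
   interior, where convexity yields a gain of order d^3. *)
Lemma heat_bath_sqr_le (R : realType) (q C : R) (n A B : nat) :
  0 < q < 1 -> (A <= B <= n)%N ->
  let Q := 3 * (q * (1 + q) / (1 - q) ^+ 3) in C = Q + 2 * (Q + 1) ^+ 2 ->
  \sum_(0 <= j < n.+1) q ^+ ((A - j) + (j - B)) *
    (j%:R ^+ 2 - (A%:R ^+ 2 + B%:R ^+ 2) / 2 - C) <= 0.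
Proof.
move=> /andP[q0 q1] /andP[AB Bn] Q CE.
have Q0 : 0 <= Q.
  apply: mulr_ge0 => //; apply: divr_ge0; first by apply: mulr_ge0; lra.
  by rewrite exprn_ge0 // subr_ge0 ltW.
have C0 : 0 <= C by rewrite CE; have := sqr_ge0 (Q + 1); lra.
have qk k : 0 <= q ^+ k by rewrite exprn_ge0 // ltW.
pose d := (B - A)%N; have Bd : B%:R = A%:R + d%:R :> R by rewrite -natrD subnKC.
have d0 : 0 <= d%:R :> R by []; have A0 : 0 <= A%:R :> R by [].
pose M : R := (A%:R ^+ 2 + B%:R ^+ 2) / 2.
rewrite (@big_cat_nat _ _ _ A) //=; last by lia.
rewrite (@big_cat_nat _ _ _ B.+1 A) //=; last by lia.
(* Below [A], put j = A - (k + 1). The bounding terms are nonnegative for k >= A, so both tails can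
   be extended to the same range k < n and added termwise. *)
have S1 : \sum_(0 <= j < A) q ^+ (A - j + (j - B)) * (j%:R ^+ 2 - M - C) <=
    \sum_(0 <= k < n) q ^+ k.+1 * (2 * k.+1%:R ^+ 2 - 2 * k.+1%:R * A%:R + k.+1%:R * d%:R - d%:R * A%:R).
  rewrite big_nat_rev /= add0n.
  apply: le_trans (sum_nat_widen (leq_trans AB Bn) _); last first.
    move=> k Ak; apply: mulr_ge0 => //.
    have kA : A%:R <= k.+1%:R :> R by rewrite ler_nat leqW.
    have -> : 2 * k.+1%:R ^+ 2 - 2 * k.+1%:R * A%:R + k.+1%:R * d%:R - d%:R * A%:R =
      (2 * k.+1%:R + d%:R) * (k.+1%:R - A%:R) :> R by ring.
    by rewrite mulr_ge0 ?subr_ge0 ?addr_ge0 ?mulr_ge0.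
  rewrite big_nat_cond [leRHS]big_nat_cond; apply: ler_sum => k /andP[/andP[_ kA] _].
  rewrite (_ : (A - (A - k.+1) + (A - k.+1 - B))%N = k.+1); last by lia.
  rewrite ler_wpM2l // natrB // /M Bd.
  have := mulr_ge0 (ler0n R k.+1) d0; have := sqr_ge0 (k.+1%:R : R).
  have := sqr_ge0 (d%:R : R); rewrite !expr2; lra.
have S3 : \sum_(B.+1 <= j < n.+1) q ^+ (A - j + (j - B)) * (j%:R ^+ 2 - M - C) <=
    \sum_(0 <= k < n) q ^+ k.+1 * (d%:R * A%:R + d%:R ^+ 2 / 2 + 2 * k.+1%:R * (A%:R + d%:R) + k.+1%:R ^+ 2).
  rewrite -[X in \sum_(X <= _ < _) _]add0n big_addn subSS.
  apply: le_trans (sum_nat_widen (leq_subr B n) _); last first.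
    move=> k _; apply: mulr_ge0 => //.
    by rewrite !addr_ge0 ?mulr_ge0 ?addr_ge0 ?invr_ge0 ?exprn_ge0.
  apply: ler_sum => k _; rewrite addnS -addSn.
  rewrite (_ : (A - (k.+1 + B) + (k.+1 + B - B))%N = k.+1); last by lia.
  rewrite ler_wpM2l // natrD /M Bd; rewrite !expr2; lra.
have S2 : \sum_(A <= j < B.+1) q ^+ (A - j + (j - B)) * (j%:R ^+ 2 - M - C) =
    (d%:R + 1) * (d%:R - d%:R ^+ 2) / 6 - C * (d%:R + 1).
  rewrite -[X in \sum_(X <= _ < _) _]add0n big_addn subSn // -/d.
  rewrite -(sum_sqr_interval A%:R) -Bd -/M.
  transitivity (\sum_(0 <= k < d.+1) ((A%:R + k%:R) ^+ 2 - M - C)).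
    rewrite big_nat_cond [RHS]big_nat_cond; apply: eq_bigr => k /andP[/andP[_ kd] _].
    rewrite (_ : (A - (k + A) + (k + A - B))%N = 0%N); last by lia.
    by rewrite expr0 mul1r natrD [k%:R + _]addrC.
  by rewrite sumrB; congr (_ - _); rewrite sumr_const_nat subn0 natr1 mulr_natr.
have S13 : \sum_(0 <= k < n) q ^+ k.+1 * (2 * k.+1%:R ^+ 2 - 2 * k.+1%:R * A%:R + k.+1%:R * d%:R - d%:R * A%:R) +
    \sum_(0 <= k < n) q ^+ k.+1 * (d%:R * A%:R + d%:R ^+ 2 / 2 + 2 * k.+1%:R * (A%:R + d%:R) + k.+1%:R ^+ 2)
    <= Q * (1 + d%:R) ^+ 2.
  rewrite -big_split /=.
  have := sum_sqr_geometric_le n.+1 (introT andP (conj (ltW q0) q1)).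
  rewrite big_nat_recl //= expr0n mulr0 add0r => h.
  (* With x = k + 1 the terms in [A] cancel, leaving 3x^2 + 3xd + d^2/2, which is at most 3x^2 (1 +
     d)^2 since x >= 1; hence the 3 in [Q]. *)
  apply: (@le_trans _ _ (3 * (\sum_(0 <= k < n) q ^+ k.+1 * k.+1%:R ^+ 2) * (1 + d%:R) ^+ 2)).
    rewrite [leRHS]mulrAC [leRHS]mulr_sumr; apply: ler_sum => k _; rewrite -mulrDr [leRHS]mulrCA ler_wpM2l //.
    have k1 : 1 <= k.+1%:R :> R by rewrite ler1n.
    set x := k.+1%:R in k1 *; set y := d%:R in d0 *.
    have x2 : 1 <= x ^+ 2 by rewrite exprn_ege1.
    have := mulr_ge0 (mulr_ge0 (le_trans ler01 k1) (eqbRL (subr_ge0 _ _) k1)) d0.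
    have := mulr_ge0 (eqbRL (subr_ge0 _ _) x2) (sqr_ge0 y).
    have := mulr_ge0 (sqr_ge0 x) d0; have := sqr_ge0 y; rewrite !expr2; lra.
  by rewrite ler_wpM2r ?sqr_ge0 // /Q; lra.
rewrite -/M S2.
(* After division by d + 1, [C] must dominate a concave quadratic in d; its maximum is at d = 3Q +
   1/2. *)
have fin : Q * (1 + d%:R) + (d%:R - d%:R ^+ 2) / 6 <= C.
  rewrite CE; have := sqr_ge0 (d%:R - 3 * Q - 2^-1 : R); have := sqr_ge0 Q.
  rewrite !expr2; lra.
have := mulr_ge0 (eqbRL (subr_ge0 _ _) fin) (addr_ge0 ler01 d0).
move: S1 S3 S13; rewrite !expr2; lra.
Qed.

(** The heat-bath mean of [phi] exceeds the average over the two neighbours by at most [C], written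
    with unnormalised weights. *)
Definition heat_bath_convex (R : realType) (beta C : R) (n : nat) (phi : nat -> R) : Prop :=
  forall a b, (a <= n)%N -> (b <= n)%N ->
    \sum_(j < n.+1) expR (- beta * (absdiff a j + absdiff j b)%N%:R) *
      (phi j - (phi a + phi b) / 2 - C) <= 0.

(** Between the neighbours the energy is constant, and outside them both edges lengthen together, so
    the decay rate is [q = expR (- beta) ^+ 2]. The constant is uniform in [n]. *)
Lemma heat_bath_convex_sqr (R : realType) (beta : R) : 0 < beta ->
  exists C : R, 0 <= C /\ forall n, heat_bath_convex beta C n (fun j => j%:R ^+ 2).
Proof.
move=> b0; pose q := expR (- beta) ^+ 2.
have q01 : 0 < q < 1.
  by rewrite exprn_gt0 ?expR_gt0 //= exprn_ilt1 ?expR_ge0 // expR_lt1 oppr_lt0.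
pose Q := 3 * (q * (1 + q) / (1 - q) ^+ 3).
exists (Q + 2 * (Q + 1) ^+ 2); split.
  have Q0 : 0 <= Q.
    case/andP: q01 => q0 q1; apply: mulr_ge0 => //; apply: divr_ge0.
      by apply: mulr_ge0; lra.
    by rewrite exprn_ge0 // subr_ge0 ltW.
  by have := sqr_ge0 (Q + 1); lra.
move=> n a b; wlog ab : a b / (a <= b)%N => [H|] an bn.
  have [ab|/ltnW ba] := leqP a b; first exact: H.
  have := H b a ba bn an; congr (_ <= 0); apply: eq_bigr => j _.
  rewrite [b%:R ^+ 2 + _]addrC; congr (expR (_ * _%:R) * _).
  by rewrite /absdiff; lia.
have := heat_bath_sqr_le q01 (introT andP (conj ab bn)) (erefl (Q + 2 * (Q + 1) ^+ 2)).
rewrite -(ler_pM2l (expR_gt0 (- beta * (b - a)%N%:R))) mulr0 big_mkord mulr_sumr.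
congr (_ <= 0); apply: eq_bigr => j _; rewrite mulrA; congr (_ * _).
rewrite /q -exprM -expRM_natr -expRD -mulrDr -natrD; congr (expR (_ * _%:R)).
rewrite /absdiff; lia.
Qed.

Lemma heat_bath_convex_rev (R : realType) (beta C : R) (n : nat) (phi : nat -> R) :
  heat_bath_convex beta C n phi -> heat_bath_convex beta C n (fun j => phi (n - j)%N).
Proof.
move=> H a b an bn; have := H _ _ (leq_subr a n) (leq_subr b n).
congr (_ <= 0); rewrite (reindex_inj rev_ord_inj) /=; apply: eq_bigr => j _.
have jn : (j <= n)%N by rewrite -ltnS.
rewrite subSS; congr (expR (_ * _%:R) * _).
by rewrite /absdiff; lia.
Qed.

(** * Weighted sums of column heights and their drift *)

Definition col_weight (R : realType) (n p : nat) : R := p%:R * (n.+1%:R - p%:R).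

Definition lyapunov (R : realType) (n : nat) (phi : nat -> R) (eta : config n) : R :=
  \sum_(i < n) col_weight R n i.+1 * phi (eta i).

Lemma col_weight_bounds (R : realType) (n : nat) (i : 'I_n) :
  0 <= col_weight R n i.+1 <= n%:R ^+ 2.
Proof.
have i1 : i.+1%:R <= n%:R :> R by rewrite ler_nat.
have i0 : 1 <= i.+1%:R :> R by rewrite ler1n.
rewrite /col_weight -[n.+1%:R]natr1 expr2.
have n0 : 0 <= n%:R :> R by [].
apply/andP; split; first by apply: mulr_ge0; lra.
by apply: ler_pM; lra.
Qed.

Lemma sum_col_weight (R : realType) (n : nat) :
  \sum_(i < n) col_weight R n i.+1 = n%:R * (n%:R + 1) * (n%:R + 2) / 6.
Proof.
have E m : \sum_(i < m) col_weight R n i.+1 =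
    (n%:R + 1) * (m%:R * (m%:R + 1) / 2) - m%:R * (m%:R + 1) * (2 * m%:R + 1) / 6.
  elim: m => [|m IH]; first by rewrite big_ord0; field.
  by rewrite big_ord_recr /= IH /col_weight -!natr1; field.
by rewrite E; field.
Qed.

(** Summation by parts. Boundary terms in [f] are kept, because the reflected square equals n^2 at
    height 0. *)
Lemma sum_laplacian (R : realType) (W f : nat -> R) (n : nat) :
  \sum_(i < n) W i.+1 * (f i + f i.+2 - 2 * f i.+1) =
  \sum_(i < n) f i.+1 * (W i + W i.+2 - 2 * W i.+1)
    + (W 1%N * f 0%N - W 0%N * f 1%N) - (W n.+1 * f n - W n * f n.+1).
Proof.
elim: n => [|n IH]; first by rewrite !big_ord0; ring.
by rewrite !big_ord_recr /= IH; ring.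
Qed.

Lemma lyapunov_upd (R : realType) (n : nat) (phi : nat -> R) (eta : config n)
    (i : 'I_n) (j : 'I_n.+1) :
  lyapunov phi (upd eta i j) = lyapunov phi eta + col_weight R n i.+1 * (phi j - phi (eta i)).
Proof.
rewrite /lyapunov (bigD1 i) //= [in RHS](bigD1 i) //= updE.
rewrite [X in _ + X = _](eq_bigr (fun k : 'I_n => col_weight R n k.+1 * phi (eta k))).
  by ring.
by move=> k /negbTE ki; rewrite ffunE ki.
Qed.

Definition heat_bath (R : realType) (beta : R) (n : nat) (eta : config n) (i : 'I_n)
  (j : 'I_n.+1) : R := mu beta (upd eta i j) / \sum_(j' < n.+1) mu beta (upd eta i j').

Lemma sum_mu_upd_gt0 (R : realType) (beta : R) (n : nat) (eta : config n) (i : 'I_n) :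
  0 < \sum_(j < n.+1) mu beta (upd eta i j).
Proof.
rewrite (bigD1 ord0) //= ltr_pwDl ?mu_gt0 //.
by apply: sumr_ge0 => j _; rewrite ltW ?mu_gt0.
Qed.

Lemma heat_bath_ge0 (R : realType) (beta : R) (n : nat) (eta : config n) (i : 'I_n) j :
  0 <= heat_bath beta eta i j.
Proof. by rewrite divr_ge0 ?ltW ?mu_gt0 ?sum_mu_upd_gt0. Qed.

Lemma heat_bath_sum1 (R : realType) (beta : R) (n : nat) (eta : config n) (i : 'I_n) :
  \sum_j heat_bath beta eta i j = 1.
Proof. by rewrite /heat_bath -mulr_suml divff // gt_eqF ?sum_mu_upd_gt0. Qed.

Lemma expect_Pcol (R : realType) (beta : R) (n : nat) (eta : config n) (g : config n -> R) :
  expect (@Pcol R beta n eta) g =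
  n%:R^-1 * \sum_(i < n) \sum_(j < n.+1) heat_bath beta eta i j * g (upd eta i j).
Proof.
rewrite /expect /Pcol; under eq_bigr do rewrite -mulrA mulr_suml.
rewrite -mulr_sumr exchange_big /=; congr (_ * _); apply: eq_bigr => i _.
under eq_bigr do rewrite mulr_suml.
rewrite exchange_big /=; apply: eq_bigr => j _.
rewrite (bigD1 (upd eta i j)) //= eqxx mul1r [X in _ + X]big1 ?addr0 // => y /negbTE ->.
by rewrite !mul0r.
Qed.

Lemma Pcol_stochastic (R : realType) (beta : R) (n : nat) :
  (0 < n)%N -> stochastic (@Pcol R beta n).
Proof.
move=> n0; split=> [x y|x].
  rewrite mulr_ge0 ?invr_ge0 //; apply: sumr_ge0 => i _; apply: sumr_ge0 => j _.
  by rewrite mulr_ge0 ?heat_bath_ge0.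
transitivity (expect (@Pcol R beta n x) (fun=> 1)).
  by rewrite /expect; under [RHS]eq_bigr do rewrite mulr1.
rewrite expect_Pcol -[RHS](invr_sum_const 1 n0); congr (_ * _); apply: eq_bigr => i _.
by under eq_bigr do rewrite mulr1; rewrite heat_bath_sum1.
Qed.

Lemma heat_bath_expect_le (R : realType) (beta C : R) (n : nat) (phi : nat -> R)
    (eta : config n) (i : 'I_n) : heat_bath_convex beta C n phi ->
  \sum_j heat_bath beta eta i j * phi j <= (phi (ht eta i) + phi (ht eta i.+2)) / 2 + C.
Proof.
move=> /(_ _ _ (ht_le eta i) (ht_le eta i.+2)) H; set m := (_ / 2 : R) in H *.
rewrite -subr_le0.
have -> : \sum_j heat_bath beta eta i j * phi j - (m + C) =
    \sum_j heat_bath beta eta i j * (phi j - m - C).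
  rewrite -[m + C]mulr1 -(heat_bath_sum1 beta eta i) mulr_sumr -sumrB.
  by apply: eq_bigr => j _; ring.
have [c [c0 Hc]] := mu_upd beta eta i; have Z0 := sum_mu_upd_gt0 beta eta i.
set Z := \sum_(j < n.+1) mu beta (upd eta i j) in Z0.
have := mulr_ge0_le0 (ltW (divr_gt0 c0 Z0)) H.
rewrite mulr_sumr; congr (_ <= 0); apply: eq_bigr => j _.
by rewrite /heat_bath -/Z Hc; ring.
Qed.

(* Only the boundary heights feed the weighted sum: the discrete Laplacian of
   [col_weight] is the constant -2. *)
Lemma lyapunov_drift (R : realType) (beta C : R) (n : nat) (phi : nat -> R)
    (eta : config n) : (0 < n)%N -> 0 <= C -> (forall j, (j <= n)%N -> 0 <= phi j <= n%:R ^+ 2) ->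
  heat_bath_convex beta C n phi ->
  expect (@Pcol R beta n eta) (lyapunov phi) <= lyapunov phi eta + (1 + C) * n%:R ^+ 2.
Proof.
move=> n0 C0 phib H; have nR : 0 < n%:R :> R by rewrite ltr0n.
have step i : \sum_(j < n.+1) heat_bath beta eta i j * lyapunov phi (upd eta i j) <=
    lyapunov phi eta + col_weight R n i.+1 * C
    + col_weight R n i.+1 * (phi (ht eta i) + phi (ht eta i.+2) - 2 * phi (ht eta i.+1)) / 2.
  have -> : \sum_(j < n.+1) heat_bath beta eta i j * lyapunov phi (upd eta i j) =
      lyapunov phi eta + col_weight R n i.+1 *
        (\sum_j heat_bath beta eta i j * phi j - phi (ht eta i.+1)).
    under eq_bigr do rewrite lyapunov_upd mulrDr.
    rewrite big_split /= -mulr_suml heat_bath_sum1 mul1r; congr (_ + _).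
    rewrite -[phi (ht eta i.+1)]mul1r -(heat_bath_sum1 beta eta i) mulr_suml -sumrB mulr_sumr.
    by apply: eq_bigr => j _; rewrite ht_ord; ring.
  have [w0 _] := andP (col_weight_bounds R i).
  have := ler_wpM2l w0 (heat_bath_expect_le eta i H).
  set s := \sum_j _; set w := col_weight _ _ _; move=> h; lra.
rewrite expect_Pcol.
apply: (@le_trans _ _ (n%:R^-1 * (\sum_(i < n) lyapunov phi eta + n%:R ^+ 3 * (1 + C)))); last first.
  rewrite mulrDr invr_sum_const // lerD2l le_eqVlt; apply/orP; left; apply/eqP.
  by field; rewrite gt_eqF.
rewrite ler_wpM2l ?invr_ge0 //.
apply: le_trans (ler_sum _ (fun i _ => step i)) _.
rewrite !big_split /= -addrA lerD2l -!mulr_suml.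
rewrite (sum_laplacian (col_weight R n) (fun k => phi (ht eta k))).
have -> : \sum_(i < n) phi (ht eta i.+1) *
    (col_weight R n i + col_weight R n i.+2 - 2 * col_weight R n i.+1) =
    - 2 * \sum_(i < n) phi (ht eta i.+1).
  by rewrite mulr_sumr; apply: eq_bigr => i _; rewrite /col_weight -!natr1; ring.
have s0 : 0 <= \sum_(i < n) phi (ht eta i.+1).
  by apply: sumr_ge0 => i _; have /andP[] := phib _ (ht_le eta i.+1).
(* Each end carries weight [n] and contributes at most n^3; halved, the two give n^3, hence n^2 per
   step after averaging over sites. *)
have /andP[_ p0] := phib _ (ht_le eta 0).
have /andP[_ p1] := phib _ (ht_le eta n.+1).
have w : (\sum_(i < n) col_weight R n i.+1) * C <= n%:R ^+ 3 * C.
  rewrite ler_wpM2r // exprS mulr_natl -[X in _ *+ X](card_ord n) -sumr_const.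
  by apply: ler_sum => i _; have /andP[] := col_weight_bounds R i.
have e1 : col_weight R n 1 = n%:R by rewrite /col_weight -natr1; ring.
have e0 : col_weight R n 0 = 0 by rewrite /col_weight mul0r.
have en : col_weight R n n = n%:R by rewrite /col_weight -natr1; ring.
have en1 : col_weight R n n.+1 = 0 by rewrite /col_weight subrr mulr0.
rewrite e1 e0 en en1 !mul0r.
have := ler_wpM2l (ltW nR) p0; have := ler_wpM2l (ltW nR) p1.
rewrite -exprS; lra.
Qed.

Lemma Pcol_lower_bound (R : realType) (beta : R) : 0 < beta ->
  exists c : R, 0 < c /\ exists N : nat, forall n : nat, (N <= n)%N ->
     forall t : nat, mixed_at (@Pcol R beta n) (@mu R beta n) t ->
       c * (n%:R ^+ 3) <= t%:R.
Proof.
move=> b0; have [C [C0 sqrC]] := heat_bath_convex_sqr b0.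
have K0 : 0 < 1 + C by lra.
exists (96 * (1 + C))^-1; split; first by rewrite invr_gt0 mulr_gt0.
exists 1%N => n n0 t mix; have nR : 0 < n%:R :> R by rewrite ltr0n.
have sP := Pcol_stochastic beta n0.
pose phi0 (j : nat) : R := j%:R ^+ 2.
pose phi1 (j : nat) : R := (n - j)%N%:R ^+ 2.
pose wt : R := \sum_(i < n) col_weight R n i.+1.
(* A linear observable can be bounded by the [phi0] functional near the floor and, after reflection,
   by the [phi1] functional near the ceiling; the factor [n] brings it to their scale. *)
pose g (eta : config n) : R := n%:R * lyapunov (fun j => j%:R) eta.
have w0 (i : 'I_n) : 0 <= col_weight R n i.+1 by have /andP[] := col_weight_bounds R i.
have n2 j : (j <= n)%N -> 0 <= phi0 j <= n%:R ^+ 2.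
  by move=> jn; rewrite sqr_ge0 lerXn2r ?nnegrE //= ler_nat.
have gb eta : 0 <= g eta <= n%:R ^+ 2 * wt.
  rewrite /g mulr_ge0 //=; last by apply: sumr_ge0 => i _; rewrite mulr_ge0.
  rewrite expr2 -mulrA ler_wpM2l // mulr_sumr; apply: ler_sum => i _.
  by rewrite mulrC ler_wpM2r // ler_nat -ltnS.
have drift phi j : (forall j, (j <= n)%N -> 0 <= phi j <= n%:R ^+ 2) ->
    heat_bath_convex beta C n phi -> phi j = 0 -> (j <= n)%N ->
    expect (law (@Pcol R beta n) t (flat (inord j : 'I_n.+1))) (lyapunov phi) <=
    (1 + C) * n%:R ^+ 2 * t%:R.
  move=> phib Hphi pj jn.
  apply: le_trans (expect_drift (g := lyapunov phi) (K := (1 + C) * n%:R ^+ 2) _ _ sP _) _.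
    by move=> z; apply: lyapunov_drift.
  rewrite gerDr /lyapunov big1 // => i _; by rewrite ffunE inordK ?pj ?mulr0.
have lo := drift phi0 0%N n2 (sqrC n) (expr0n _ _) (leq0n n).
have hi := drift phi1 n (fun j _ => n2 _ (leq_subr j n)) (heat_bath_convex_rev (sqrC n)).
have {}hi := hi _ (leqnn n); rewrite /phi1 subnn expr0n in hi; have {}hi := hi erefl.
rewrite -/phi1 in hi.
(* [n j <= n^2 / 8 + 2 j^2] turns the quadratic bounds into linear ones. *)
have glo eta : g eta <= n%:R ^+ 2 * wt / 8 + 2 * lyapunov phi0 eta.
  have -> : g eta = \sum_(i < n) col_weight R n i.+1 * (n%:R * (eta i)%:R).
    by rewrite /g mulr_sumr; apply: eq_bigr => i _; ring.
  rewrite /wt mulrAC mulr_sumr mulr_sumr -big_split /=; apply: ler_sum => i _.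
  have -> : n%:R ^+ 2 / 8 * col_weight R n i.+1 + 2 * (col_weight R n i.+1 * phi0 (eta i)) =
    col_weight R n i.+1 * (n%:R ^+ 2 / 8 + 2 * phi0 (eta i)) by ring.
  rewrite ler_wpM2l // /phi0.
  have := sqr_ge0 (n%:R - 4 * (eta i)%:R : R); rewrite !expr2; lra.
have ghi eta : n%:R ^+ 2 * wt - g eta <= n%:R ^+ 2 * wt / 8 + 2 * lyapunov phi1 eta.
  have -> : n%:R ^+ 2 * wt - g eta =
      \sum_(i < n) col_weight R n i.+1 * (n%:R * (n - eta i)%N%:R).
    rewrite /g /wt !mulr_sumr -sumrB; apply: eq_bigr => i _.
    by rewrite natrB; [ring | rewrite -ltnS].
  rewrite /wt [n%:R ^+ 2 * _ / 8]mulrAC mulr_sumr mulr_sumr -big_split /=; apply: ler_sum => i _.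
  have -> : n%:R ^+ 2 / 8 * col_weight R n i.+1 + 2 * (col_weight R n i.+1 * phi1 (eta i)) =
    col_weight R n i.+1 * (n%:R ^+ 2 / 8 + 2 * phi1 (eta i)) by ring.
  rewrite ler_wpM2l // /phi1.
  have := sqr_ge0 (n%:R - 4 * (n - eta i)%N%:R : R); rewrite !expr2; lra.
have affine x (u v : R) (f : config n -> R) :
    expect (law (@Pcol R beta n) t x) (fun y => u + v * f y) =
    u + v * expect (law (@Pcol R beta n) t x) f.
  rewrite /expect mulr_sumr -[X in X + _]mulr1 -(law_sum1 t x sP) mulr_sumr -big_split /=.
  by apply: eq_bigr => y _; ring.
have mono x (f h : config n -> R) : (forall y, f y <= h y) ->
    expect (law (@Pcol R beta n) t x) f <= expect (law (@Pcol R beta n) t x) h.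
  by move=> fh; apply: ler_sum => y _; rewrite ler_wpM2l // law_ge0.
have := mono (flat (inord 0)) _ _ glo; rewrite affine => elo.
have : expect (law (@Pcol R beta n) t (flat (inord n))) (fun y => n%:R ^+ 2 * wt + (-1) * g y) <=
    expect (law (@Pcol R beta n) t (flat (inord n)))
      (fun y => n%:R ^+ 2 * wt / 8 + 2 * lyapunov phi1 y).
  by apply: mono => y; rewrite mulN1r.
rewrite !affine => ehi.
have diff := mixed_expect_diff (flat (inord n)) (flat (inord 0)) sP mix gb.
(* The range n^2 wt is at most half of itself by mixing, plus two eighths, plus four times the drift
   (1 + C) n^2 t. As [wt] is at least n^3 / 6, the constant is 1 / (96 (1 + C)). *)
have key : n%:R ^+ 2 * wt <= n%:R ^+ 2 * (16 * ((1 + C) * t%:R)) by lra.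
rewrite ler_pM2l ?exprn_gt0 // /wt sum_col_weight in key.
rewrite mulrC ler_pdivrMr ?mulr_gt0 //.
have := sqr_ge0 (n%:R : R); move: key; rewrite !exprS expr0; lra.
Qed.

Theorem theorem3p6 (R : realType) (beta : R) (hbeta : 0 < beta) :
  (exists c : R, 0 < c /\ exists N : nat, forall n : nat, (N <= n)%N ->
     forall t : nat, mixed_at (@Pcol R beta n) (@mu R beta n) t ->
       c * (n%:R ^+ 3) <= t%:R)
  /\
  (exists c : R, 0 < c /\ exists N : nat, forall n : nat, (N <= n)%N ->
     forall t : nat, mixed_at (@Pss R beta n) (@mu R beta n) t ->
       c * (n%:R ^+ 3) <= t%:R).
Proof. by split; [apply: Pcol_lower_bound | apply: Pss_lower_bound]. Qed.
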